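(* Let $A$ be a nonsingular $d\times d$ integer matrix and let $m\in\mathbb{Z}_{\geq 0}^d$. Then $$\sum_{\xi\in T_A^*}[\cos(2\pi\xi)]^m=\frac{|\det A|}{2^{|m|}}\sum_{\substack{x\in A\mathbb{Z}^d,\ y\in\mathbb{Z}_{\geq 0}^d\\ \mathrm{abs}(x)+2y=m}}\frac{m!}{(\mathrm{abs}(x)+y)!\,y!}.$$
   Context: Here $T_A^*=(A^{T})^{-1}\mathbb{Z}^d/\mathbb{Z}^d$ (a finite quotient group). For $\xi\in T_A^*$, $\cos(2\pi\xi):=(\cos(2\pi\xi_1),\dots,\cos(2\pi\xi_d))\in\mathbb{R}^d$ (computed from any representative of $\xi$). For $x\in\mathbb{Z}^d$: $\mathrm{abs}(x)=(|x_1|,\dots,|x_d|)$ and $|x|=\sum_{i=1}^d|x_i|$. For $m\in\mathbb{Z}_{\geq 0}^d$ and $v\in\mathbb{R}^d$: $m!=m_1!m_2!\cdots m_d!$ and $v^m=v_1^{m_1}v_2^{m_2}\cdots v_d^{m_d}$ (with $0^0=1$). *)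

(* Defs.v *)
From HB Require Import structures.
From mathcomp Require Import all_boot all_order all_algebra.
From mathcomp Require Import archimedean ring_quotient generic_quotient.
From mathcomp Require Import all_classical all_reals all_analysis.

Set Implicit Arguments.
Unset Strict Implicit.
Unset Printing Implicit Defensive.

Import Order.TTheory GRing.Theory Num.Theory.

Local Open Scope classical_set_scope.
Local Open Scope ring_scope.
Local Open Scope quotient_scope.

(* Sums over sets are finitely supported sums (0 when the support is infinite);
   (A^T)^-1 Z^d / Z^d and the set of pairs (x, y) with abs x + 2 y = m are
   finite when A is nonsingular, so these are ordinary finite sums. *)

Definition int_lattice (R : realType) (d : nat) (v : 'cV[R]_d) : bool :=
  v \is a mxOver Num.int.

Lemma int_lattice_closed (R : realType) (d : nat) :
  zmod_closed (@int_lattice R d).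
Proof.
split=> [|u v]; first by apply/mxOverP => i j; rewrite mxE.
move=> /mxOverP uZ /mxOverP vZ; apply/mxOverP => i j.
by rewrite !mxE rpredB ?uZ ?vZ.
Qed.

HB.instance Definition _ (R : realType) (d : nat) :=
  GRing.isZmodClosed.Build 'cV[R]_d (@int_lattice R d)
    (@int_lattice_closed R d).

Definition torus (R : realType) (d : nat) : Type :=
  Quotient.quot (GRing.ZmodClosed.clone _ (@int_lattice R d) _).

HB.instance Definition _ (R : realType) (d : nat) :=
  ZmodQuotient.on (torus R d).

(* Every element of (A^T)^-1 Z^d / Z^d is a class modulo Z^d, hence a point of
   the torus R^d / Z^d. *)
Definition dual_quotient (R : realType) (d : nat) (A : 'M[int]_d) :
    set (torus R d) :=
  [set \pi_(torus R d) (invmx (map_mx intr A^T) *m map_mx intr z) |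
    z in [set: 'cV[int]_d]].
Arguments dual_quotient R {d} A.

Definition vec_cos2pi (R : realType) (d : nat) (v : 'cV[R]_d) : 'cV[R]_d :=
  \col_i cos (2 * pi * v i 0).

Definition torus_cos2pi (R : realType) (d : nat) (xi : torus R d) : 'cV[R]_d :=
  vec_cos2pi (repr xi).

Lemma cos_add_2pi_int (R : realType) (x : R) (k : int) :
  cos (x + 2 * pi * k%:~R) = cos x.
Proof.
have H (y : R) (n : nat) : cos (y + 2 * pi * n%:R) = cos y.
  by rewrite mulr_natr (mulrC 2) mulr_natr (periodicn (@cosD2pi R)).
case: k => n; first exact: H.
have -> : (Negz n)%:~R = - n.+1%:R :> R by [].
by have := H (x - 2 * pi * n.+1%:R) n.+1; rewrite subrK mulrN => ->.
Qed.

Lemma torus_cos2pi_pi (R : realType) (d : nat) (v : 'cV[R]_d) :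
  torus_cos2pi (\pi_(torus R d) v) = vec_cos2pi v.
Proof.
rewrite /torus_cos2pi; set w := repr _.
have : \pi_(torus R d) w == \pi_(torus R d) v by rewrite reprK.
rewrite -Quotient.idealrBE => /mxOverP wv.
apply/matrixP => i j; rewrite !mxE.
have /intrP[k wvk] := wv i 0; rewrite !mxE in wvk.
have -> : w i 0 = v i 0 + k%:~R by rewrite -wvk subrKC.
by rewrite mulrDr cos_add_2pi_int.
Qed.

Definition lattice (d : nat) (A : 'M[int]_d) : set 'cV[int]_d :=
  range (fun z : 'cV[int]_d => A *m z).

Definition abs_vec (d : nat) (x : 'cV[int]_d) : 'cV[nat]_d := map_mx absz x.

Definition vec_size (d : nat) (m : 'cV[nat]_d) : nat := (\sum_i m i 0%R)%N.

Definition vec_fact (d : nat) (m : 'cV[nat]_d) : nat := (\prod_i (m i 0%R)`!)%N.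

Definition vec_pow (R : realType) (d : nat) (v : 'cV[R]_d) (m : 'cV[nat]_d) : R :=
  \prod_i v i 0 ^+ m i 0.

(* Main.v *)
(* Write e(t) = exp(2 i pi t).  Expanding each (e(xi_i) + e(-xi_i))^(m_i) by the
   binomial theorem gives
    2^|m| cos(2 pi xi)^m = sum_k prod_i C(m_i, k_i) e(xi . (m - 2k)).
   Summing over xi in T_A^*, orthogonality of characters leaves |det A| times the
   terms with x = m - 2k in A Z^d.  Setting y = min(k, m - k) turns these k into
   the pairs (x, y) with abs(x) + 2y = m, and {k_i, m_i - k_i} becomes
   {|x_i| + y_i, y_i}, so the product of binomials is m! / ((abs(x) + y)! y!). *)

Require Import Defs.
From mathcomp Require Import all_boot all_order all_algebra.
From mathcomp Require Import complex.
From mathcomp Require Import all_classical all_reals all_analysis.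
From mathcomp Require Import ring lra zify.

Set Implicit Arguments.
Unset Strict Implicit.
Unset Printing Implicit Defensive.

Import Order.TTheory GRing.Theory Num.Theory.
Local Open Scope classical_set_scope.
Local Open Scope ring_scope.

(** * The character e(t) = exp(2 i pi t) and its geometric sums *)

Definition expi (R : realType) (t : R) : R[i] :=
  Complex (cos (2 * pi * t)) (sin (2 * pi * t)).

Lemma expi0 (R : realType) : expi (0 : R) = 1.
Proof. by rewrite /expi mulr0 cos0 sin0. Qed.

Lemma expiD (R : realType) (s t : R) : expi (s + t) = expi s * expi t.
Proof.
rewrite /expi mulrDr cosD sinD; apply/eqP; rewrite eq_complex /=.
by rewrite eqxx addrC eqxx.
Qed.

Lemma expiMn (R : realType) (t : R) (n : nat) : expi (t *+ n) = expi t ^+ n.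
Proof.
elim: n => [|n IHn]; first by rewrite mulr0n expi0 expr0.
by rewrite mulrS expiD IHn exprS.
Qed.

Lemma expi_sum (R : realType) (I : finType) (F : I -> R) :
  expi (\sum_i F i) = \prod_i expi (F i).
Proof. exact: (big_morph (@expi R) (@expiD R) (@expi0 R)). Qed.

(** Removing the floor of [t] leaves [s] in [0, 1). Since cos(2 pi s) = 1 - 2 sin(pi s)^2, the value
    1 forces sin(pi s) = 0; the sine is positive on ]0, pi[, so [s] is 0. *)
Lemma expi_eq1 (R : realType) (t : R) : (expi t == 1) = (t \is a Num.int).
Proof.
have expiDz (s : R) (k : int) :
    complex.Re (expi (s + k%:~R)) = complex.Re (expi s).
  by rewrite /expi /= mulrDr cos_add_2pi_int.
apply/idP/idP => [/eqP t1|/intrP[k ->]]; last first.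
  have := expiDz 0 k; rewrite add0r expi0 /= => k1.
  rewrite eq_complex /= k1 eqxx /=; apply/eqP.
  by apply: cos1sin0; rewrite k1 normr1.
rewrite -[t](subrK (Num.floor t)%:~R) rpredD ?intr_int //.
have := expiDz (t - (Num.floor t)%:~R) (Num.floor t).
rewrite subrK t1 /=; set s := t - _ => /esym s1.
have /andP[s0 s_lt1] : 0 <= s < 1.
  by rewrite subr_ge0 floor_le_tmp ltrBlDl -intrD1 floorD1_gt.
have : sin (pi * s) == 0.
  move: s1; rewrite -mulrA mulr_natl cos_mulr2n cos2sin2 => s1.
  rewrite -sqrf_eq0; apply/eqP; lra.
rewrite le_eqVlt in s0; case/orP: s0 => [/eqP <- //|s0].
rewrite gt_eqF // sin_gt0_pi // mulr_gt0 ?pi_gt0 //=.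
by rewrite gtr_pMr ?pi_gt0.
Qed.

Lemma cos_expn_expi (R : realType) (t : R) (n : nat) :
  ((2 * cos (2 * pi * t)) ^+ n)%:C%C =
  \sum_(k < n.+1) 'C(n, k)%:R * expi (t * (n%:Z - k%:Z *+ 2)%:~R).
Proof.
rewrite rmorphXn /=.
have -> : (2 * cos (2 * pi * t))%:C%C = expi t + expi (- t).
  rewrite /expi mulrN cosN sinN; apply/eqP; rewrite eq_complex /=.
  by rewrite subrr eqxx mulr_natl mulr2n eqxx.
rewrite exprDn; apply: eq_bigr => k _.
rewrite mulr_natl -!expiMn -expiD; congr (expi _ *+ _).
have kn : (k <= n)%N by rewrite -ltnS.
rewrite -mulr_natr -[- t *+ _]mulr_natr natrB // rmorphB /= rmorphMn /=.
by rewrite -!pmulrn; ring.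
Qed.

Lemma int_divr_dvdz (R : realType) (D y : int) : D != 0 ->
  (y%:~R / D%:~R \is a @Num.int R) = (D %| y)%Z.
Proof.
move=> D0; have D0R : D%:~R != 0 :> R by rewrite intr_eq0.
apply/intrP/dvdzP => -[k yk]; exists k; last first.
  by rewrite yk intrM mulfK.
by apply: (@mulrIz R 1) => //; rewrite ?oner_eq0 // intrM -yk divfK.
Qed.

(** One-dimensional orthogonality: a geometric sum of ratio e(y/D). The ratio is 1 exactly when [D]
    divides [y]; otherwise multiplying by e(y/D) - 1 telescopes the sum. *)
Lemma sum_expi (R : realType) (D y : int) : D != 0 ->
  \sum_(k < `|D|%N) expi (k%:R * (y%:~R / D%:~R) : R) =
  if (D %| y)%Z then `|D|%N%:R else 0.
Proof.
move=> D0; set u : R := y%:~R / D%:~R.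
under eq_bigr do rewrite mulr_natl expiMn.
rewrite -(@int_divr_dvdz R) // -expi_eq1 -/u; case: eqP => [->|/eqP u1].
  under eq_bigr do rewrite expr1n.
  by rewrite sumr_const card_ord.
apply: (@mulfI _ (expi u - 1)); first by rewrite subr_eq0.
rewrite mulr0 -subrX1; apply/eqP; rewrite subr_eq0 -expiMn expi_eq1.
(* [D] may be negative: |D| is a sign times [D], so |D| (y/D) is [y] up to sign, an integer. *)
rewrite -mulr_natl natr_absz normrEsign intrM -mulrA [X in _ * X]mulrC.
by rewrite divfK ?intr_eq0 // -intrM intr_int.
Qed.

(** * Orthogonality of characters on the dual quotient *)

Definition pairing (R : realType) (d : nat) (v : 'cV[R]_d) (x : 'cV[int]_d) : R :=
  \sum_i v i 0 * (x i 0)%:~R.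

Lemma pairingE (R : realType) (d : nat) (v : 'cV[R]_d) (x : 'cV[int]_d) :
  pairing v x = (v^T *m map_mx intr x) 0 0.
Proof. by rewrite mxE; apply: eq_bigr => i _; rewrite !mxE. Qed.

Lemma eq_pi_torus (R : realType) (d : nat) (u v : 'cV[R]_d) :
  (\pi_(torus R d)%qT u == \pi_(torus R d)%qT v) = (u - v \is a mxOver Num.int).
Proof. by rewrite -Quotient.idealrBE. Qed.

(* The Smith normal form [A^T = L D Q] identifies [A^-T Z^d / Z^d] with
   [Q^-1 D^-1 Z^d / Z^d], hence with the product of the [Z / D_i Z]. *)
Lemma smith_dual (R : realType) (d : nat) (A L Q : 'M[int]_d) (D : 'rV[int]_d)
    (w : 'cV[int]_d) :
  L \in unitmx -> Q \in unitmx -> (forall i, D 0 i != 0) ->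
  A^T = L *m diag_mx D *m Q ->
  invmx (map_mx intr A^T) *m map_mx intr (L *m w) =
  map_mx intr (invmx Q) *m \col_i ((w i 0)%:~R / (D 0 i)%:~R) :> 'cV[R]_d.
Proof.
move=> Lu Qu D0 AE; set v := \col_i _.
have unitR (M : 'M[int]_d) : \det M != 0 ->
    map_mx (intr : int -> R) M \in unitmx.
  by rewrite unitmxE det_map_mx unitfE intr_eq0.
have unit0 (M : 'M[int]_d) : M \in unitmx -> \det M != 0.
  by rewrite unitmxE; apply: contraTneq => ->; rewrite unitr0.
have Dv : map_mx intr (diag_mx D) *m v = map_mx intr w.
  rewrite map_diag_mx mul_diag_mx; apply/matrixP => i j; rewrite !mxE.
  by rewrite [j]ord1 mulrC divfK // intr_eq0.
have -> : map_mx intr (L *m w) =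
          map_mx intr A^T *m (map_mx intr (invmx Q) *m v) :> 'cV[R]_d.
  rewrite AE !map_mxM -Dv -!mulmxA; congr (_ *m (_ *m _)).
  by rewrite mulmxA -map_mxM mulmxV // map_mx1 mul1mx.
rewrite mulKmx //; apply: unitR.
rewrite AE !det_mulmx det_diag !mulf_neq0 ?unit0 //.
by apply/prodf_neq0 => i _.
Qed.

(** Transposing the factorization gives A = Q^T D L^T. As L^T permutes Z^d, the unimodular map Q^-T
    carries A Z^d onto D Z^d, where membership is read coordinatewise. *)
Lemma smith_lattice (d : nat) (A L Q : 'M[int]_d) (D : 'rV[int]_d)
    (x : 'cV[int]_d) :
  L \in unitmx -> Q \in unitmx -> A^T = L *m diag_mx D *m Q ->
  lattice A x <-> (forall i, (D 0%R i %| ((invmx Q)^T *m x)%R i 0%R)%Z).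
Proof.
move=> Lu Qu AE.
have {}AE : A = Q^T *m (diag_mx D *m L^T).
  by rewrite -[LHS]trmxK AE !trmx_mul tr_diag_mx.
split=> [[z _ <-] i|Dx].
  rewrite AE !mulmxA -trmx_mul mulmxV // trmx1 mul1mx -mulmxA.
  by rewrite mul_diag_mx !mxE dvdz_mulr.
pose w := \col_i divz (((invmx Q)^T *m x) i 0) (D 0 i).
exists (invmx L^T *m w) => //=.
rewrite AE -!mulmxA mulKVmx ?unitmx_tr //.
have -> : diag_mx D *m w = (invmx Q)^T *m x.
  apply/matrixP => i j; rewrite mul_diag_mx !mxE [j]ord1.
  by rewrite mulrC; have := Dx i; rewrite mxE => /divzK.
by rewrite mulmxA -trmx_mul mulVmx // trmx1 mul1mx.
Qed.

Lemma fsum_pred (V : nmodType) (T : finType) (P : {pred T}) (F : T -> V) :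
  \sum_(x \in [set` P]) F x = \sum_(x in P) F x.
Proof.
by rewrite -(bigfs _ (index_enum_uniq T)) // => x _; rewrite mem_index_enum.
Qed.

Lemma pairing_mulmx (R : realType) (d : nat) (M : 'M[int]_d) (v : 'cV[R]_d)
    (x : 'cV[int]_d) :
  pairing (map_mx intr M *m v) x = pairing v (M^T *m x).
Proof. by rewrite !pairingE trmx_mul map_mxM map_trmx mulmxA. Qed.

Lemma Smith_normal_form_sq (d : nat) (M : 'M[int]_d) :
  exists2 L : 'M[int]_d, L \in unitmx &
  exists2 Q : 'M[int]_d, Q \in unitmx &
  exists D : 'rV[int]_d, M = L *m diag_mx D *m Q.
Proof.
have [L Lu [Q Qu [s _ ->]]] := int_Smith_normal_form M.
exists L => //; exists Q => //; exists (\row_i s`_i).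
congr (_ *m _ *m _); apply/matrixP => i j; rewrite !mxE.
by rewrite val_eqE; case: eqVneq => [->|].
Qed.

Lemma absz_det_unitmx (d : nat) (M : 'M[int]_d) : M \in unitmx -> `|\det M|%N = 1%N.
Proof. by rewrite unitmxE => /orP[] /eqP ->. Qed.

(** One list of real representatives serves both sums, so characters can be evaluated on vectors
    without being descended to the torus. In Smith coordinates the list is a box, and the character
    sum factors into geometric sums, one for each D_i. *)
Lemma dual_quotient_enum (R : realType) (d : nat) (A : 'M[int]_d) :
  \det A != 0 ->
  exists s : seq 'cV[R]_d,
    (forall F : torus R d -> R,
       \sum_(xi \in dual_quotient R A) F xi =
       \sum_(v <- s) F (\pi_(torus R d)%qT v)) /\
    (forall x : 'cV[int]_d,
       \sum_(v <- s) expi (pairing v x) =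
       if `[< lattice A x >] then `|\det A|%N%:R else 0).
Proof.
move=> A0; have [L Lu [Q Qu [D AE]]] := Smith_normal_form_sq A^T.
have detAE : `|\det A|%N = (\prod_i `|D 0%R i|)%N.
  rewrite -det_tr AE !det_mulmx !abszM (absz_det_unitmx Lu).
  by rewrite (absz_det_unitmx Qu) mul1n muln1 det_diag (big_morph absz abszM absz1).
have D0 i : D 0 i != 0.
  apply: contra_neq A0 => Di0; apply/eqP.
  by rewrite -absz_eq0 detAE (bigD1 i) //= Di0.
(* A common bound for the |D_i| puts all digits in the single finite type ['I_N]; [box] then
   restores the individual ranges. *)
pose N := (\max_i `|D 0%R i|)%N.
have DN i : (`|D 0%R i| <= N)%N by exact: leq_bigmax.
pose box := family (fun i (k : 'I_N) => (k < `|D 0%R i|)%N).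
pose h (f : {ffun 'I_d -> 'I_N}) : 'cV[R]_d :=
  map_mx intr (invmx Q) *m \col_i ((f i)%:R / (D 0 i)%:~R).
have hE f : h f = invmx (map_mx intr A^T) *m
                  map_mx intr (L *m \col_i (f i)%:Z).
  rewrite (smith_dual _ _ Lu Qu D0 AE); congr (_ *m _).
  by apply/matrixP => i j; rewrite !mxE.
exists [seq h f | f <- enum box]; split=> [F|x]; last first.
  rewrite big_map big_enum /=.
  transitivity (\sum_(f in box) \prod_i expi ((f i)%:R *
      ((((invmx Q)^T *m x) i 0)%:~R / (D 0 i)%:~R) : R)).
    apply: eq_bigr => f _; rewrite pairing_mulmx -expi_sum; congr expi.
    by apply: eq_bigr => i _; rewrite !mxE mulrAC mulrA.
  rewrite -(bigA_distr_big_dep _ (fun i (k : 'I_N) => expi (k%:R *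
      ((((invmx Q)^T *m x) i 0)%:~R / (D 0 i)%:~R) : R))) /=.
  under eq_bigr => i _.
    rewrite -(big_ord_widen _ (fun k => expi (k%:R *
      ((((invmx Q)^T *m x) i 0)%:~R / (D 0 i)%:~R) : R)) (DN i)) sum_expi //.
    over.
  case: asboolP => [/(smith_lattice _ Lu Qu AE) Dx|nx].
    under eq_bigr do rewrite Dx.
    by rewrite detAE natr_prod.
  have /existsP[i Dxi] : [exists i, ~~ (D 0%R i %| ((invmx Q)^T *m x)%R i 0%R)%Z].
    rewrite -negb_forall; apply: contra_notN nx => /forallP Dx.
    by apply/(smith_lattice _ Lu Qu AE).
  by rewrite (bigD1 i) //= (negPf Dxi) mul0r.
have -> : dual_quotient R A =
          (fun f => \pi_(torus R d)%qT (h f)) @` [set` box].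
  apply/seteqP; split=> [_ [z _ <-]|_ [f _ <-]]; last first.
    by exists (L *m \col_i (f i)%:Z) => //; rewrite hE.
  (* Every class is reached: reducing w_i modulo D_i changes w_i / D_i by an integer, and Q^-1
     preserves integrality. *)
  have [{z}w ->] : exists w, z = L *m w.
    by exists (invmx L *m z); rewrite mulKVmx.
  have wD i : (`|(w i 0%R %% D 0%R i)%Z| < `|D 0%R i|)%N.
    by rewrite -ltz_nat gez0_abs ?modz_ge0 // ltz_mod.
  pose f := [ffun i => Ordinal (leq_trans (wD i) (DN i))].
  exists f.
    by apply/familyP => i; rewrite ffunE; apply: wD.
  apply/eqP; rewrite eq_pi_torus.
  rewrite (smith_dual _ _ Lu Qu D0 AE) -mulmxBr.
  apply: mxOverM.
    by apply/mxOverP => i j; rewrite mxE intr_int.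
  apply/mxOverP => i j; rewrite !mxE ffunE /=.
  rewrite -mulrBl pmulrn gez0_abs ?modz_ge0 // -intrB int_divr_dvdz //.
  by rewrite -eqz_mod_dvd modz_mod.
rewrite fsbig_image; first by rewrite fsum_pred big_map big_enum.
(* Distinct digits give distinct classes: multiplying by Q leaves (f_i - g_i) / D_i integral, and
   both digits lie below |D_i|. *)
move=> f g; rewrite !inE => /familyP fD /familyP gD /eqP.
rewrite eq_pi_torus -mulmxBr => fg.
have {fg} : map_mx intr Q *m (h f - h g) \is a mxOver Num.int.
  apply: mxOverM; last by rewrite /h -mulmxBr.
  by apply/mxOverP => i j; rewrite mxE intr_int.
rewrite /h -mulmxBr mulmxA -map_mxM mulmxV // map_mx1 mul1mx => /mxOverP fg.
apply/ffunP => i; apply/val_inj => /=.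
have := fg i 0; rewrite !mxE -mulrBl !pmulrn -intrB int_divr_dvdz //.
rewrite -eqz_mod_dvd.
have sm (k : 'I_N) : (k < `|D 0%R i|)%N -> (k %% D 0%R i)%Z = k.
  by move=> kD; rewrite -modz_abs modz_small // ltz_nat.
by rewrite (sm _ (fD i)) (sm _ (gD i)) => /eqP[].
Qed.

(** * Binomial expansion and the passage from k to (x, y) *)

Definition binom_box (d : nat) (m : 'cV[nat]_d) :
    {pred {ffun 'I_d -> 'I_(vec_size m).+1}} :=
  family (fun i (k : 'I_(vec_size m).+1) => (k < (m i 0%R).+1)%N).
Arguments binom_box {d} m f.

Definition binom_freq (d n : nat) (m : 'cV[nat]_d) (f : {ffun 'I_d -> 'I_n}) :
    'cV[int]_d :=
  \col_i ((m i 0)%:Z - (f i)%:Z *+ 2).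

Definition binom_min (d n : nat) (m : 'cV[nat]_d) (f : {ffun 'I_d -> 'I_n}) :
    'cV[nat]_d :=
  \col_i minn (f i) (m i 0%R - f i).

Lemma abs_freqD_minn (n k : nat) : (k <= n)%N ->
  (`|(n%:Z - k%:Z *+ 2)%R| + minn k (n - k))%N = maxn k (n - k).
Proof. by lia. Qed.

Lemma leq_vec_size (d : nat) (m : 'cV[nat]_d) (i : 'I_d) : (m i 0%R <= vec_size m)%N.
Proof. by rewrite /vec_size (bigD1 i) //= leq_addr. Qed.

Lemma vec_pow_cos2pi_expand (R : realType) (d : nat) (v : 'cV[R]_d)
    (m : 'cV[nat]_d) :
  (2 ^+ vec_size m * vec_pow (vec_cos2pi v) m)%:C%C =
  \sum_(f in binom_box m)
    (\prod_i 'C(m i 0%R, f i))%N%:R * expi (pairing v (binom_freq m f)).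
Proof.
rewrite /vec_size /vec_pow -prodrXr -big_split rmorph_prod /=.
under eq_bigr => i _.
  rewrite mxE -exprMn cos_expn_expi.
  (* The ranges k_i <= m_i vary with i. Widening them to the common bound |m| lets the product of
     sums distribute over functions into one finite type. *)
  rewrite (big_ord_widen _ (fun k => 'C(m i 0%R, k)%:R *
    expi (v i 0 * (Posz (m i 0%R) - Posz k *+ 2)%:~R)) (_ : _ <= (vec_size m).+1)%N).
    over.
  by rewrite ltnS leq_vec_size.
rewrite bigA_distr_big_dep; apply: eq_bigr => f _.
rewrite big_split natr_prod -expi_sum /=; congr (_ * expi _).
by apply: eq_bigr => i _; rewrite mxE.
Qed.

Lemma binom_box_bij (d : nat) (m : 'cV[nat]_d) (P : set 'cV[int]_d) :
  set_bij [set` [pred f in binom_box m | `[< P (binom_freq m f) >]]]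
    [set p : 'cV[int]_d * 'cV[nat]_d | P p.1 /\ abs_vec p.1 + p.2 *+ 2 = m]
    (fun f => (binom_freq m f, binom_min m f)).
Proof.
split=> [f /= /andP[/familyP fm /asboolP Pf]|f g|[x y] /= [Px xy]].
- split=> //; apply/matrixP => i j; rewrite [j]ord1 mulr2n !mxE.
  have := fm i; rewrite unfold_in ltnS => fi.
  by rewrite -[LHS]/(_ + (_ + _))%N addnA abs_freqD_minn // addnC addn_min_max subnKC.
(* The first component suffices: x = m - 2k determines k. *)
- rewrite !inE => _ _ [/matrixP fg _]; apply/ffunP => i; apply/val_inj => /=.
  have := fg i 0; rewrite !mxE; lia.
- have xyi i : (`|x i 0%R| + 2 * y i 0%R)%N = m i 0%R.
    by rewrite -xy mulr2n !mxE mul2n -addnn.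
  (* Since x = m - 2k, the sign of x_i tells whether k_i is the smaller or the larger of k_i and m_i
     - k_i, that is, y_i or m_i - y_i. *)
  pose k i := if 0 <= x i 0 then y i 0 else (m i 0%R - y i 0%R)%N.
  have km i : (k i <= m i 0%R)%N by rewrite /k; have := xyi i; case: ifP; lia.
  pose f : {ffun 'I_d -> 'I_(vec_size m).+1} := [ffun i => inord (k i)].
  have fE i : f i = k i :> nat.
    by rewrite ffunE inordK // ltnS (leq_trans (km i)) // leq_vec_size.
  have xE : binom_freq m f = x.
    apply/matrixP => i j; rewrite [j]ord1 !mxE fE /k; have := xyi i.
    by case: ifP; lia.
  exists f.
    apply/andP; split; last by apply/asboolP; rewrite xE.
    by apply/familyP => i; rewrite unfold_in fE ltnS.
  congr (_, _) => //; apply/matrixP => i j; rewrite [j]ord1 !mxE fE /k.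
  by have := xyi i; case: ifP; lia.
Qed.

Lemma binom_box_fact (R : realType) (d : nat) (m : 'cV[nat]_d)
    (f : {ffun 'I_d -> 'I_(vec_size m).+1}) :
  f \in binom_box m ->
  (vec_fact m)%:R /
    (vec_fact (abs_vec (binom_freq m f) + binom_min m f)%R *
     vec_fact (binom_min m f))%N%:R = (\prod_i 'C(m i 0%R, f i))%N%:R :> R.
Proof.
move=> /familyP fm.
have -> : vec_fact m = (\prod_i 'C(m i 0%R, f i) *
   (vec_fact (abs_vec (binom_freq m f) + binom_min m f)%R *
     vec_fact (binom_min m f)))%N.
  rewrite /vec_fact -!big_split /=; apply: eq_bigr => i _; rewrite !mxE.
  have := fm i; rewrite unfold_in ltnS => fi.
  rewrite -(bin_fact fi).
  rewrite -[(_ + minn _ _)%R]/(_ + minn _ _)%N abs_freqD_minn //.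
  (* The maximum and minimum are k_i and m_i - k_i in one order or the other; the product of their
     factorials is the same. *)
  by congr (_ * _)%N; case: leqP => _ //; rewrite mulnC.
rewrite natrM mulfK // pnatr_eq0 -lt0n muln_gt0 !prodn_gt0 // => i.
  by rewrite fact_gt0.
by rewrite fact_gt0.
Qed.

Theorem corollary1p1 (R : realType) (d : nat) (A : 'M[int]_d) (m : 'cV[nat]_d)
    (A_nonsingular : \det A != 0) :
  \sum_(xi \in dual_quotient R A) vec_pow (torus_cos2pi xi) m =
    (`|\det A|%:~R : R) / 2 ^+ vec_size m *
    \sum_(p \in [set p : 'cV[int]_d * 'cV[nat]_d |
                  lattice A p.1 /\ abs_vec p.1 + p.2 *+ 2 = m])
      ((vec_fact m)%:R : R) /
        (vec_fact (abs_vec p.1 + p.2)%R * vec_fact p.2)%N%:R.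
Proof.
have [s [sumE charE]] := dual_quotient_enum R A_nonsingular.
(* The right side becomes a sum of products of binomials over the k with m - 2k in A Z^d. *)
rewrite (reindex_fsbig _ _ _ _ (binom_box_bij m (lattice A))) fsum_pred /=.
under [X in _ = _ * X]eq_bigr => f Pf.
  rewrite binom_box_fact; first over.
  by case/andP: Pf.
rewrite sumE; under [LHS]eq_bigr do rewrite torus_cos2pi_pi.
apply: (@mulfI _ (2 ^+ vec_size m)); first by rewrite expf_neq0 ?pnatr_eq0.
rewrite mulrA [_ / _]mulrC mulVKf ?expf_neq0 ?pnatr_eq0 //.
(* The real identity, cleared of 2^|m|, is proved in [R[i]], where the cosines expand into
   characters. *)
apply: complexI; rewrite mulr_sumr rmorph_sum /=.
under eq_bigr do rewrite vec_pow_cos2pi_expand.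
(* With the sum over representatives innermost, orthogonality keeps exactly the frequencies in the
   lattice. *)
rewrite exchange_big /=; under eq_bigr do rewrite -mulr_sumr charE.
rewrite rmorphM rmorph_sum /= mulr_sumr big_mkcondr /=.
apply: eq_bigr => f _; case: asboolP => _; last by rewrite mulr0.
by rewrite mulrC -abszE !rmorph_nat.
Qed.
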